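(* Let $\lambda$ be a non-zero real number, let $r$ be a positive integer, and let $u\in\mathbb{C}$ with $u\neq 1$. For every integer $n\ge 0$, $$h_{n,\lambda}^{(r)}(x|u)=n!\sum_{k=0}^{n}\Bigg\{\sum_{\substack{0\le l\le n-k\\ l\ \mathrm{even}}}\frac{(1)_{\frac{l}{2},\lambda}\,h_{n-k-l,\lambda}^{(r)}(u)}{\big(\frac{l}{2}\big)!\,2^{l+k}\,(n-k-l)!\,k!}\Bigg\}H_{k,\lambda}(x),$$ where $h_{n,\lambda}^{(r)}(x|u)$ and $h_{n,\lambda}^{(r)}(u)=h_{n,\lambda}^{(r)}(0|u)$ are the degenerate Frobenius-Euler polynomials and numbers of order $r$, and $H_{k,\lambda}(x)$ are the degenerate Hermite polynomials.
   Context: Fix a non-zero real number $\lambda$. The degenerate falling factorials are $(x)_{0,\lambda}=1$ and $(x)_{n,\lambda}=x(x-\lambda)(x-2\lambda)\cdots(x-(n-1)\lambda)$ for $n\ge 1$. The degenerate exponential functions are $e_\lambda^x(t)=(1+\lambda t)^{x/\lambda}=\sum_{n\ge 0}(x)_{n,\lambda}\frac{t^n}{n!}$, regarded as formal power series in $t$, and $e_\lambda(t)=e_\lambda^1(t)$. The degenerate Hermite polynomials $H_{n,\lambda}(x)$ are defined by $$e_\lambda^{-1}(t^2)\, e_\lambda^{x}(2t)=\sum_{n=0}^\infty H_{n,\lambda}(x)\frac{t^n}{n!}.$$ For $u\in\mathbb{C}$, $u\ne 1$, the degenerate Frobenius-Euler polynomials of order $r$ are defined by $$\bigg(\frac{1-u}{e_\lambda(t)-u}\bigg)^{r}e_\lambda^x(t)=\sum_{n=0}^\infty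 h_{n,\lambda}^{(r)}(x|u)\frac{t^n}{n!},$$ and $h_{n,\lambda}^{(r)}(u)=h_{n,\lambda}^{(r)}(0|u)$. *)

(* Defs.v *)
From mathcomp Require Import all_boot all_order all_algebra.
From mathcomp Require Import complex.
From mathcomp Require Import reals.

Set Implicit Arguments.
Unset Strict Implicit.
Unset Printing Implicit Defensive.

Import GRing.Theory.

Local Open Scope ring_scope.

(* Formal power series in t over a field, given by their coefficients:
   f stands for \sum_n (f n) t^n. *)
Definition fps (K : Type) := nat -> K.

Section FormalPowerSeries.
Variable K : fieldType.
Implicit Types f g : fps K.

(* The monomial c t^m; in particular fps_monom c 0 is the constant c. *)
Definition fps_monom (c : K) (m : nat) : fps K :=
  fun n => if n == m then c else 0.

Definition fps_sub f g : fps K := fun n => f n - g n.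

Definition fps_mul f g : fps K := fun n => \sum_(i < n.+1) f i * g (n - i)%N.

Definition fps_exp f (r : nat) : fps K := iter r (fps_mul f) (fps_monom 1 0).

(* The composite f(g(t)), meaningful when g has no constant term: then g ^ k
   starts in degree k, so the powers k > n do not contribute to t^n. *)
Definition fps_comp f g : fps K :=
  fun n => \sum_(k < n.+1) f k * fps_exp g k n.

(* The first n coefficients of 1 / f, obtained by solving f * g = 1 degree by
   degree. *)
Fixpoint fps_inv_seq f (n : nat) : seq K :=
  if n is m.+1 then
    let s := fps_inv_seq f m in
    rcons s ((f 0%N)^-1 * ((m == 0%N)%:R - \sum_(i < m) f (m - i)%N * s`_i))
  else [::].

(* The inverse 1 / f, meaningful when f has a non-zero constant term. *)
Definition fps_inv f : fps K := fun n => (fps_inv_seq f n.+1)`_n.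

Lemma size_fps_inv_seq f n : size (fps_inv_seq f n) = n.
Proof. by elim: n => //= n IHn; rewrite size_rcons IHn. Qed.

Lemma nth_fps_inv_seq f n i : (i < n)%N -> (fps_inv_seq f n)`_i = fps_inv f i.
Proof.
elim: n => // n IHn; rewrite ltnS leq_eqVlt => /predU1P[-> // | lt_in].
by rewrite /= nth_rcons size_fps_inv_seq lt_in IHn.
Qed.

Lemma fps_invE f n :
  fps_inv f n =
    (f 0%N)^-1 * ((n == 0%N)%:R - \sum_(i < n) f (n - i)%N * fps_inv f i).
Proof.
rewrite {1}/fps_inv /= nth_rcons size_fps_inv_seq ltnn eqxx.
by under eq_bigr => i _ do rewrite nth_fps_inv_seq //.
Qed.

Lemma fps_mulVf f : f 0%N != 0 -> fps_mul (fps_inv f) f =1 fps_monom 1 0.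
Proof.
move=> f0 n; rewrite /fps_mul big_ord_recr /= subnn [fps_inv f n]fps_invE.
rewrite mulrAC mulVf // mul1r addrC.
under [X in _ + X]eq_bigr => i _ do rewrite mulrC.
by rewrite subrK /fps_monom; case: eqP.
Qed.

(* The numbers a_n such that f(t) = \sum_n a_n t^n / n!. *)
Definition egf_coef f (n : nat) : K := n`!%:R * f n.

End FormalPowerSeries.

Section DegenerateFunctions.
Variables (K : fieldType) (lam : K).

(* (x)_{n,lam} = x (x - lam) ... (x - (n - 1) lam) *)
Definition dfall (x : K) (n : nat) : K := \prod_(0 <= i < n) (x - i%:R * lam).

(* e_lam^x(t) = (1 + lam t)^(x / lam) *)
Definition dexp (x : K) : fps K := fun n => dfall x n / n`!%:R.

(* H_{n,lam}(x), from e_lam^{-1}(t^2) e_lam^x(2t); here e_lam^{-1} is e_lam^x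
   at x = -1. *)
Definition dhermite (n : nat) (x : K) : K :=
  egf_coef
    (fps_mul (fps_comp (dexp (- 1)) (fps_monom 1 2))
             (fps_comp (dexp x) (fps_monom 2%:R 1))) n.

(* h_{n,lam}^{(r)}(x|u), from ((1 - u) / (e_lam(t) - u))^r e_lam^x(t) *)
Definition dfrobenius_euler (r n : nat) (x u : K) : K :=
  egf_coef
    (fps_mul
       (fps_exp (fps_mul (fps_monom (1 - u) 0)
                         (fps_inv (fps_sub (dexp 1) (fps_monom u 0)))) r)
       (dexp x)) n.

Definition dfrobenius_euler_num (r n : nat) (u : K) : K :=
  dfrobenius_euler r n 0 u.

End DegenerateFunctions.

(* Main.v *)
Require Import Defs.
From mathcomp Require Import all_boot all_order all_algebra.
From mathcomp Require Import complex.
From mathcomp Require Import reals.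
From mathcomp Require Import ring.

Import GRing.Theory.
Local Open Scope ring_scope.
Local Open Scope complex_scope.

(** Replacing t by t/2 in the generating function of the H_k and multiplying by
    e_lam(t^2/4), which cancels e_lam^{-1}(t^2/4), gives
    e_lam^x(t) = e_lam(t^2/4) \sum_k H_k(x) t^k / (2^k k!).
    Multiply by ((1 - u) / (e_lam(t) - u))^r, the generating function of the
    h_n(u), and compare coefficients. *)

Section FpsRing.
Set Implicit Arguments.
Unset Strict Implicit.
Variable K : fieldType.
Implicit Types f g h : fps K.

(** Product coefficients up to degree [N] depend only on truncations at [N], so the laws of
    [{poly K}] carry over to series. *)
Definition fps_trunc f (N : nat) : {poly K} := \poly_(i < N.+1) f i.

Lemma coef_fps_trunc f N i : (i <= N)%N -> (fps_trunc f N)`_i = f i.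
Proof. by move=> le_iN; rewrite coef_poly ltnS le_iN. Qed.

Lemma fps_mulE f g n N : (n <= N)%N ->
  fps_mul f g n = (fps_trunc f N * fps_trunc g N)`_n.
Proof.
move=> le_nN; rewrite coefM; apply: eq_bigr => i _.
by rewrite !coef_fps_trunc // (leq_trans _ le_nN) ?leq_subr // -ltnS.
Qed.

Lemma eq_fps_mul f1 f2 g1 g2 :
  f1 =1 f2 -> g1 =1 g2 -> fps_mul f1 g1 =1 fps_mul f2 g2.
Proof. by move=> eqf eqg n; apply: eq_bigr => i _; rewrite eqf eqg. Qed.

Lemma fps_mulC f g : fps_mul f g =1 fps_mul g f.
Proof. by move=> n; rewrite !(fps_mulE _ _ (leqnn n)) mulrC. Qed.

Lemma fps_mulA f g h : fps_mul f (fps_mul g h) =1 fps_mul (fps_mul f g) h.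
Proof.
have mulE3 f1 f2 f3 n : fps_mul (fps_mul f1 f2) f3 n
    = (fps_trunc f1 n * fps_trunc f2 n * fps_trunc f3 n)`_n.
  rewrite coefM; apply: eq_bigr => i _.
  by rewrite -fps_mulE -1?ltnS // coef_fps_trunc ?leq_subr.
(* [mulE3] reads only left-nested products, hence the prior commutation to [(g h) f]. *)
by move=> n; rewrite fps_mulC !mulE3 mulrC mulrA.
Qed.

Lemma fps_mul_monom c m f n :
  fps_mul (fps_monom c m) f n = if (m <= n)%N then c * f (n - m)%N else 0.
Proof.
case: leqP => [le_mn | lt_nm].
  have lt_mn : (m < n.+1)%N by [].
  rewrite /fps_mul (bigD1 (Ordinal lt_mn)) //= /fps_monom eqxx big1 ?addr0 //.
  by move=> i; rewrite -val_eqE /= => /negPf->; rewrite mul0r.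
apply: big1 => i _; rewrite /fps_monom ltn_eqF ?mul0r //.
by rewrite (leq_trans _ lt_nm).
Qed.

Lemma fps_mul1 f : fps_mul (fps_monom 1 0) f =1 f.
Proof. by move=> n; rewrite fps_mul_monom subn0 mul1r. Qed.

Lemma fps_exp_monom (c : K) m k :
  fps_exp (fps_monom c m) k =1 fps_monom (c ^+ k) (k * m).
Proof.
elim: k => [|k IHk] n; first by rewrite expr0 mul0n.
rewrite [LHS]/= fps_mul_monom IHk /fps_monom exprS mulSn.
case: leqP => [le_mn | lt_nm]; last by rewrite ltn_eqF // ltn_addr.
by rewrite -(eqn_add2l m) subnKC //; case: eqP; rewrite ?mulr0.
Qed.

(** The [k]-th power of [c t^m] is [c^k t^(k m)], so only [k = n / m] can reach degree [n]. *)
Lemma fps_comp_monom f c m n : (0 < m)%N ->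
  fps_comp f (fps_monom c m) n
    = if (m %| n)%N then c ^+ (n %/ m) * f (n %/ m)%N else 0.
Proof.
move=> m_gt0; rewrite /fps_comp; under eq_bigr => k _ do rewrite fps_exp_monom.
case: (boolP (m %| n)%N) => [m_dvd_n | m_ndvd_n]; last first.
  apply: big1 => k _; rewrite /fps_monom; case: eqP => [n_eq|]; last by rewrite mulr0.
  by rewrite n_eq dvdn_mull in m_ndvd_n.
have lt_k : (n %/ m < n.+1)%N by rewrite ltnS leq_div.
rewrite (bigD1 (Ordinal lt_k)) //= /fps_monom divnK // eqxx mulrC big1 ?addr0 //.
move=> k; rewrite -val_eqE /= => /eqP k_neq.
case: eqP => [n_eq|]; last by rewrite mulr0.
by case: k_neq; rewrite [X in (X %/ _)%N]n_eq mulnK.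
Qed.

Lemma fps_comp_monom1E f m n N : (0 < m)%N -> (n <= N)%N ->
  fps_comp f (fps_monom 1 m) n = (fps_trunc f N \Po 'X^m)`_n.
Proof.
move=> m_gt0 le_nN; rewrite fps_comp_monom // coef_comp_poly_Xn //.
case: ifP => // _; rewrite expr1n mul1r coef_fps_trunc //.
exact: leq_trans (leq_div _ _) le_nN.
Qed.

(** On truncations, substituting [t^m] is polynomial composition with ['X^m], which is
    multiplicative. *)
Lemma fps_comp_monomM f g m : (0 < m)%N ->
  fps_mul (fps_comp f (fps_monom 1 m)) (fps_comp g (fps_monom 1 m))
    =1 fps_comp (fps_mul f g) (fps_monom 1 m).
Proof.
move=> m_gt0 n; rewrite [RHS]fps_comp_monom //.
transitivity (((fps_trunc f n * fps_trunc g n) \Po 'X^m)`_n).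
  rewrite comp_polyM coefM; apply: eq_bigr => i _.
  by rewrite -!fps_comp_monom1E ?leq_subr // -ltnS.
rewrite coef_comp_poly_Xn //; case: ifP => // _.
by rewrite expr1n mul1r -fps_mulE // leq_div.
Qed.

End FpsRing.

Section DegenerateExp.
Set Implicit Arguments.
Unset Strict Implicit.
Variables (K : numFieldType) (lam : K).

Lemma natrS_neq0 n : n.+1%:R != 0 :> K.
Proof. by rewrite Num.Theory.pnatr_eq0. Qed.

Lemma factr_neq0 n : n`!%:R != 0 :> K.
Proof. by rewrite Num.Theory.pnatr_eq0 -lt0n fact_gt0. Qed.

Lemma dexp0 (x : K) : dexp lam x 0 = 1.
Proof. by rewrite /dexp /dfall big_geq // divr1. Qed.

Lemma dexpS (x : K) n :
  n.+1%:R * dexp lam x n.+1 = (x - n%:R * lam) * dexp lam x n.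
Proof.
rewrite /dexp /dfall big_nat_recr //= factS natrM.
have := natrS_neq0 n; have := factr_neq0 n.
by move: (_`!%:R) (n.+1%:R) => a b a0 b0; field; rewrite a0 b0.
Qed.

(** This is [(1 + lam t) F' = x F] read on coefficients; in characteristic 0 the factor [n.+1]
    cancels, so the constant term determines the series. *)
Lemma dexp_recP (x : K) (f : fps K) : f 0%N = 1 ->
  (forall n, n.+1%:R * f n.+1 = (x - n%:R * lam) * f n) -> f =1 dexp lam x.
Proof.
move=> f0 fS; elim=> [|n IHn]; first by rewrite dexp0.
by apply: (mulfI (natrS_neq0 n)); rewrite fS dexpS IHn.
Qed.

Lemma dexp_at0 : dexp lam 0 =1 fps_monom 1 0.
Proof.
move=> n; apply/esym; move: n; apply: dexp_recP => // -[|n] /=.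
  by rewrite /fps_monom /= mul0r subr0 mul0r mulr0.
by rewrite /fps_monom /= !mulr0.
Qed.

(* The convolution satisfies the recurrence that characterizes
   [dexp lam (x + y)], namely (1 + lam t) F' = (x + y) F. *)
Lemma dexpD (x y : K) :
  fps_mul (dexp lam x) (dexp lam y) =1 dexp lam (x + y).
Proof.
apply: dexp_recP => [|n]; first by rewrite /fps_mul big_ord1 !dexp0 mulr1.
(* Leibniz rule for the derivative of the product: the weight [n.+1] splits as [i + (n.+1 - i)]. *)
have split_idx : n.+1%:R * fps_mul (dexp lam x) (dexp lam y) n.+1
  = \sum_(i < n.+2) i%:R * dexp lam x i * dexp lam y (n.+1 - i)%N
    + \sum_(i < n.+2) dexp lam x i * ((n.+1 - i)%:R * dexp lam y (n.+1 - i)%N).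
  rewrite mulr_sumr -big_split; apply: eq_bigr => i _ /=.
  by rewrite natrB ?leq_ord //; ring.
(* The term [i = 0] of the first sum and the last term of the second vanish. Shifting the first sum
   aligns the ranges, and the factors add up: [(x - i lam) + (y - (n - i) lam) = x + y - n lam]. *)
rewrite split_idx big_ord_recl mul0r mul0r add0r.
rewrite [X in _ + X]big_ord_recr /= subnn mul0r mulr0 addr0 -big_split.
rewrite mulr_sumr; apply: eq_bigr => i _ /=.
have le_in : (i <= n)%N by rewrite -ltnS.
rewrite /bump /= add1n subSS subSn // !dexpS natrB //; ring.
Qed.

Lemma dexp_hermite (x : K) :
  dexp lam x =1
    fps_mul (fun l => fps_comp (dexp lam 1) (fps_monom 1 2) l / 2%:R ^+ l)
            (fun k => dhermite lam k x / (2%:R ^+ k * k`!%:R)).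
Proof.
set A' := fps_comp _ _; pose A := fps_comp (dexp lam (-1)) (fps_monom 1 2).
pose B := fps_comp (dexp lam x) (fps_monom 2%:R 1).
(* In [t^2], this is [e_lam^1 e_lam^{-1} = e_lam^0 = 1]. *)
have A'A : fps_mul A' A =1 fps_monom 1 0.
  move=> n; rewrite fps_comp_monomM // fps_comp_monom // dexpD subrr dexp_at0.
  rewrite expr1n mul1r /fps_monom divn2.
  by case: n => [|[|n]] //=; case: ifP.
move=> n; have expn0 k : 2%:R ^+ k != 0 :> K by rewrite expf_neq0 ?natrS_neq0.
have Bn : B n = 2%:R ^+ n * dexp lam x n.
  by rewrite /B fps_comp_monom // dvd1n divn1.
(* Scaling by [2^n] undoes the substitution of [t/2]. Then [B = (A' A) B = A' (A B)], where [A B]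
   generates the Hermite polynomials. *)
apply: (mulfI (expn0 n)); rewrite -Bn -(@fps_mul1 _ B).
rewrite -(eq_fps_mul A'A (frefl B)) -fps_mulA mulr_sumr; apply: eq_bigr => i _.
rewrite /dhermite /egf_coef -/A -/B.
have -> : 2%:R ^+ n = 2%:R ^+ i * 2%:R ^+ (n - i) :> K.
  by rewrite -exprD subnKC ?leq_ord.
have := expn0 i; have := expn0 (n - i)%N; have := factr_neq0 (n - i).
move: (_`!%:R) (_ ^+ (n - i)) (_ ^+ i) => a b c a0 b0 c0.
by field; rewrite a0 b0 c0.
Qed.

End DegenerateExp.

Theorem theorem4 (R : realType) (lam : R) (r : nat) (u : R[i])
  (hlam : lam != 0) (hr : (0 < r)%N) (hu : u != 1) (n : nat) (x : R[i]) :
  dfrobenius_euler lam%:C r n x u =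
    n`!%:R *
    \sum_(0 <= k < n.+1)
      (\sum_(0 <= l < (n - k).+1 | ~~ odd l)
         (dfall lam%:C 1 l./2 * dfrobenius_euler_num lam%:C r (n - k - l) u) /
         ((l./2)`!%:R * 2%:R ^+ (l + k) * (n - k - l)`!%:R * k`!%:R)) *
      dhermite lam%:C k x.
Proof.
rewrite /dfrobenius_euler_num /dfrobenius_euler.
set F := fps_exp _ r; rewrite {1}/egf_coef; congr (_ * _).
(* The Hermite series becomes the outer factor, giving the sum over [k]; [F] times the even series
   gives the inner sum over [l]. *)
rewrite (eq_fps_mul (frefl F) (@dexp_hermite _ lam%:C x)) fps_mulA fps_mulC.
rewrite big_mkord; apply: eq_bigr => k _.
rewrite mulrC fps_mulC [fps_mul _ F _]/fps_mul !mulr_suml big_mkord [RHS]big_mkcond.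
apply: eq_bigr => l _.
(* A series in [t^2] has no odd coefficients, which matches the filter on [l]. *)
rewrite fps_comp_monom // dvdn2 divn2; case: ifP => _; last by rewrite !mul0r.
(* At [x = 0] the exponential factor is 1, so the numbers are the coefficients of [F] times
   factorials. *)
rewrite /egf_coef (eq_fps_mul (frefl F) (@dexp_at0 _ lam%:C)) fps_mulC fps_mul1.
rewrite expr1n mul1r /dexp exprD.
have expn0 m : 2%:R ^+ m != 0 :> R[i] by rewrite expf_neq0 ?natrS_neq0.
have := expn0 l; have := expn0 k; have := @factr_neq0 R[i] k.
have := @factr_neq0 R[i] l./2; have := @factr_neq0 R[i] (n - k - l).
move: (_ ^+ l) (_ ^+ k) (k`!%:R) (l./2`!%:R) ((n - k - l)`!%:R).
by move=> a b c d e e0 d0 c0 b0 a0; field; rewrite ?a0 ?b0 ?c0 ?d0 ?e0.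
Qed.
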